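(* Let $(P,\le,0,1)$ be a complemented poset of finite length. If $U\big(x^+,L(x,y)\big)\subseteq U(y)$ for all $x,y\in P$, then for all $x,y,z\in P$, $x\circ y\le z$ implies $x\le y\to z$. If $L\big(x,U(x^+,y)\big)\subseteq L(y)$ for all $x,y\in P$, then for all $x,y,z\in P$, $x\le y\to z$ implies $x\circ y\le z$.
   Context: $(P,\le,0,1)$ is a bounded poset with $0\ne1$, complemented (every element has a complement $b$ with $a\vee b=1$, $a\wedge b=0$), of finite length (no infinite chains). $x^+$ denotes the set of all complements of $x$. $\mathrm{Max}\,A$, $\mathrm{Min}\,A$ are the sets of maximal, minimal elements of $A$; $L(A)$, $U(A)$ the sets of lower, upper bounds, with $L(A,B):=L(A\cup B)$ and $U(x^+,L(x,y)):=U(x^+\cup L(x,y))$ etc. Define $a\circ b:=\mathrm{Max}\,L(a,b)$ and $a\to b:=\mathrm{Min}\,U(a^+,b)$. For sets, $A\le B$ means $x\le y$ for all $x\in A$, $y\in B$ (singletons identified with elements). *)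

(* Defs.v *)
From mathcomp Require Import all_boot all_order.
From mathcomp Require Import boolp classical_sets functions cardinality.

Set Implicit Arguments.
Unset Strict Implicit.
Unset Printing Implicit Defensive.

Local Open Scope classical_set_scope.
Local Open Scope order_scope.

Section Poset.
Context {d : Order.disp_t} {P : porderType d}.
Implicit Types A B : set P.

Definition finite_length : Prop :=
  forall C : set P, total_on C (fun x y => x <= y) -> finite_set C.

Definition Max A : set P := [set a | A a /\ forall b, A b -> a <= b -> b = a].
Definition Min A : set P := [set a | A a /\ forall b, A b -> b <= a -> b = a].

Definition set_le A B : Prop := forall x y, A x -> B y -> x <= y.

End Poset.
Arguments finite_length {d} P.

Section BoundedPoset.
Context {d : Order.disp_t} {P : tbPOrderType d}.
Implicit Types a b x : P.

(* P need not be a lattice: the join and the meet of x and b are required to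
   exist and to equal the top and the bottom, respectively. *)
Definition complements x : set P :=
  [set b | supremums [set x; b] \top /\ infimums [set x; b] \bot].

Definition circ a b : set P := Max (lbound [set a; b]).
Definition arrow a b : set P := Min (ubound (complements a `|` [set b])).

End BoundedPoset.

Definition complemented {d : Order.disp_t} (P : tbPOrderType d) : Prop :=
  forall x : P, complements x !=set0.

(* Main.v *)
(** By finite length every element of a set lies below a maximal one and above
    a minimal one, so [x \o y <= z] means [L(x, y) <= z] and [x <= y -> z] means
    [x <= U(y^+, z)].  In the first implication an element of [y -> z] is then
    an upper bound of [y^+] and [L(y, x)], hence of [x]; in the second an element
    of [x \o y] is a lower bound of [y] and [U(y^+, z)], hence of [z]. *)
Require Import Defs.
From mathcomp Require Import all_boot all_order.
From mathcomp Require Import boolp classical_sets functions cardinality.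

Import Order.Theory.

Local Open Scope classical_set_scope.
Local Open Scope order_scope.

(** Induction on an enumeration of [C]: by totality the new element is comparable with the greatest
    element of the rest, and the larger of the two is greatest. *)
Lemma finite_chain_greatest {d : Order.disp_t} {P : porderType d}
    {C : set P} :
  finite_set C -> C !=set0 -> total_on C (fun x y => x <= y) ->
  exists2 m, C m & ubound C m.
Proof.
move=> /finite_seqP[s ->]; elim: s => [[x]//|x s IHs] _ tot.
have [s0|/eqP/set0P sN0] := pselect ([set` s] = set0).
  exists x => [|y]; first exact: mem_head.
  rewrite /= inE => /predU1P[->//|ys].
  by have : [set` s] y by []; rewrite s0.
have [||m ms ub_m] := IHs => //.
  by move=> y z ys zs; apply: tot; rewrite /= inE (ys, zs) orbT.
have [xm|mx] := tot x m (mem_head _ _) (mem_behead (s := x :: s) ms).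
  exists m => [|y]; first exact: (mem_behead (s := x :: s)).
  by rewrite /= inE => /predU1P[->//|/ub_m].
exists x => [|y]; first exact: mem_head.
by rewrite /= inE => /predU1P[->//|/ub_m/le_trans]; apply.
Qed.

(** Zorn's lemma on the elements of [A] above [a]: finite length makes every chain finite, so its
    greatest element bounds it. *)
Lemma exists_Max_ge {d : Order.disp_t} {P : porderType d}
    {A : set P} {a : P} :
  finite_length P -> A a -> exists2 m, Max A m & a <= m.
Proof.
move=> finP Aa; pose T := {y : P | A y /\ a <= y}.
have [||||[m [Am am]] max_m] := @Zorn T (fun u v => sval u <= sval v).
- by move=> ?; exact: lexx.
- by move=> u v w; exact: le_trans.
- move=> [u pu] [v pv] /= uv vu; apply: eq_exist.
  by apply/le_anti; rewrite uv vu.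
(* Adjoining [a], which lies below all of [C], keeps a chain and gives the empty chain a bound
   too. *)
- move=> C totC; pose D := a |` [set sval u | u in C].
  have totD : total_on D (fun x y => x <= y).
    move=> _ _ [->|[u Cu <-]] [->|[v Cv <-]]; [by left| | |exact: totC].
      by left; case: (svalP v).
    by right; case: (svalP u).
  have [|m Dm ub_m] := finite_chain_greatest (finP D totD) _ totD.
    by exists a; left.
  have pm : A m /\ a <= m.
    by case: Dm => [->|[[u pu] _ <-]].
  by exists (exist _ m pm) => u Cu; apply: ub_m; right; exists u.
exists m => //; split=> // b Ab mb.
by have /(_ mb)[] := max_m (exist _ b (conj Ab (le_trans am mb))).
Qed.

(** Reversing the order preserves chains, so minimal elements come from maximal ones in [P^d]. *)
Lemma finite_length_dual {d : Order.disp_t} {P : porderType d} :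
  finite_length P -> finite_length P^d.
Proof. by move=> finP C totC; apply: finP => x y Cx Cy; exact: totC. Qed.

Lemma exists_Min_le {d : Order.disp_t} {P : porderType d}
    {A : set P} {a : P} :
  finite_length P -> A a -> exists2 m, Min A m & m <= a.
Proof. by move=> /finite_length_dual finP; exact: (@exists_Max_ge _ P^d A a). Qed.

Theorem theorem4p9 (d : Order.disp_t) (P : tbPOrderType d)
    (P01 : (\bot : P) <> \top)
    (Pcompl : complemented P)
    (Pfin : finite_length P) :
  ((forall x y : P,
      ubound (complements x `|` lbound [set x; y]) `<=` ubound [set y]) ->
   forall x y z : P,
     set_le (circ x y) [set z] -> set_le [set x] (arrow y z)) /\
  ((forall x y : P,
      lbound ([set x] `|` ubound (complements x `|` [set y]))
        `<=` lbound [set y]) ->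
   forall x y z : P,
     set_le [set x] (arrow y z) -> set_le (circ x y) [set z]).
Proof.
split=> [H x y z xyz x' w -> [ub_w _]|H x y z xyz w z' [lb_w _] ->].
  apply: (H y x) => // t [yt|lb_t]; first by apply: ub_w; left.
  have [|m xym tm] := @exists_Max_ge _ P (lbound [set x; y]) t Pfin _.
    by rewrite setUC.
  (* The chain is [t <= m <= z <= w], with [m] in [circ x y]. *)
  by apply: (le_trans tm); apply: (le_trans (xyz m z xym erefl));
    apply: ub_w; right.
apply: (H y z) => // t [->|ub_t]; first by apply: lb_w; right.
(* The chain is [w <= x <= m <= t], with [m] in [arrow y z]. *)
have [m yzm mt] := exists_Min_le Pfin ub_t.
by apply: le_trans mt; apply: le_trans (xyz x m erefl yzm); apply: lb_w; left.
Qed.
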